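(* Let $\mathbb{H}$ be a real or complex Hilbert space, let $A\in\mathbb{B}(\mathbb{H})$ be a nonzero positive operator, and let $T\in\mathbb{B}_{A^{1/2}}(\mathbb{H})$ be such that $\|T\|_A\neq 0$ and $M_A(T)\neq\emptyset$. Then the following are equivalent: (i) $T$ is $A$-smooth. (ii) There exists $x_0\in\mathbb{H}$ with $\|x_0\|_A=1$ such that $M_A(T)\cap\overline{R(A)}=\{\mu x_0:|\mu|=1\}$ and $\sup\{\|Ty\|_A:\langle x_0,y\rangle_A=0,\ \|y\|_A=1\}<\|T\|_A$.
   Context: $\mathbb{B}(\mathbb{H})$ is the set of bounded linear operators on the Hilbert space $(\mathbb{H},\langle\cdot,\cdot\rangle)$; $R(A)$ is the range of $A$ and $\overline{R(A)}$ its norm closure; $\mu$ denotes a scalar. A positive operator $A$ is a self-adjoint operator with $\langle Ax,x\rangle\ge 0$ for all $x$. It induces the semi-inner product $\langle x,y\rangle_A=\langle Ax,y\rangle$ and the semi-norm $\|x\|_A=\sqrt{\langle x,x\rangle_A}=\|A^{1/2}x\|$. $\mathbb{B}_{A^{1/2}}(\mathbb{H})$ is the set of $A$-bounded operators, i.e. those $T\in\mathbb{B}(\mathbb{H})$ for which there is $c>0$ with $\|Tx\|_A\le c\|x\|_A$ for all $x\in\mathbb{H}$; for such $T$, $\|T\|_A=\sup\{\|Tx\|_A:\|x\|_A=1\}$ and $M_A(T)=\{x\in\mathbb{H}:\|x\|_A=1,\ \|Tx\|_A=\|T\|_A\}$. For $T,S\in\mathbb{B}_{A^{1/2}}(\mathbb{H})$,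 $T\perp_A^B S$ means $\|T+\lambda S\|_A\ge\|T\|_A$ for all scalars $\lambda$. An operator $T\in\mathbb{B}_{A^{1/2}}(\mathbb{H})$ with $\|T\|_A\neq 0$ is called $A$-smooth if for all $S_1,S_2\in\mathbb{B}_{A^{1/2}}(\mathbb{H})$, $T\perp_A^B S_1$ and $T\perp_A^B S_2$ imply $T\perp_A^B S_1+S_2$. The supremum of the empty set (which occurs when $A$ has rank one) is taken to be $0$. *)

(* Defs.v *)
From HB Require Import structures.
From mathcomp Require Import all_boot all_order all_algebra.
From mathcomp.real_closed Require Import complex.
From mathcomp Require Import all_classical all_reals all_analysis.

Set Implicit Arguments.
Unset Strict Implicit.
Unset Printing Implicit Defensive.

Import Order.TTheory GRing.Theory Num.Theory.
Import numFieldNormedType.Exports.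

Local Open Scope classical_set_scope.
Local Open Scope ring_scope.

Inductive scalar_kind := RealScalars | ComplexScalars.

Definition scalars (R : realType) (k : scalar_kind) : numFieldType :=
  match k with
  | RealScalars => R
  | ComplexScalars => R[i]
  end.

Definition sconj (R : realType) (k : scalar_kind) :
    scalars R k -> scalars R k :=
  match k with
  | RealScalars => idfun
  | ComplexScalars => @conjc R
  end.

Definition sRe (R : realType) (k : scalar_kind) : scalars R k -> R :=
  match k with
  | RealScalars => idfun
  | ComplexScalars => @complex.Re R
  end.

(* [{dot V for theta}] is a positive definite hermitian form, linear in the
   first argument and theta-linear in the second.  Over [R[i]] the norm is
   [R[i]]-valued, and [0 <= z] says that z is real and nonnegative. *)
Record hilbertType (R : realType) (k : scalar_kind) := HilbertType {
  hilbert_sort :> completeNormedModType (scalars R k);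
  inner : {dot hilbert_sort for @sconj R k};
  hilbert_normE : forall x : hilbert_sort, `|x| ^+ 2 = inner x x
}.

Section SemiHilbert.
Variables (R : realType) (k : scalar_kind) (H : hilbertType R k).
Local Notation K := (scalars R k).
Implicit Types (A T S : H -> H) (x y : H).

Definition bounded_operator T : Prop :=
  exists c : K, 0 < c /\ forall x, `|T x| <= c * `|x|.

Definition self_adjoint A : Prop :=
  forall x y, inner H (A x) y = inner H x (A y).

Definition positive_operator A : Prop :=
  [/\ bounded_operator A, self_adjoint A & forall x, 0 <= inner H (A x) x].

Definition innerA A x y : K := inner H (A x) y.

Definition normA A x : R := Num.sqrt (sRe (innerA A x x)).

Definition A_bounded A T : Prop :=
  bounded_operator T /\
  exists c : R, 0 < c /\ forall x, normA A (T x) <= c * normA A x.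

Definition opnormA A T : R :=
  sup [set normA A (T x) | x in [set x | normA A x = 1]].

(* M_A(T) *)
Definition normingA A T : set H :=
  [set x | normA A x = 1 /\ normA A (T x) = opnormA A T].

Definition orthoA A T S : Prop :=
  forall lambda : K, opnormA A T <= opnormA A (fun x => T x + lambda *: S x).

(* Meant for A-bounded linear T with a nonzero A-norm. *)
Definition A_smooth A T : Prop :=
  forall S1 S2 : {linear H -> H}, A_bounded A S1 -> A_bounded A S2 ->
    orthoA A T S1 -> orthoA A T S2 -> orthoA A T (fun x => S1 x + S2 x).

(* The real [sup] of the library satisfies [sup set0 = 0] (lemma [sup0]), which
   is the convention wanted when no y is A-orthogonal to x0 with A-norm 1. *)
Definition sup_orthA A T (x0 : H) : R :=
  sup [set normA A (T y) | y in [set y | innerA A x0 y = 0 /\ normA A y = 1]].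

End SemiHilbert.

(* Main.v *)
From HB Require Import structures.
Require Import Defs.
From mathcomp Require Import all_boot all_order all_algebra.
From mathcomp.real_closed Require Import complex.
From mathcomp Require Import all_classical all_reals all_analysis.
From mathcomp Require Import ring lra.

Set Implicit Arguments.
Unset Strict Implicit.

Import Order.TTheory GRing.Theory Num.Theory.
Import numFieldNormedType.Exports.

Local Open Scope classical_set_scope.
Local Open Scope ring_scope.

(** Write [t] for the A-norm of [T] and, for a vector [x0] of A-norm 1 at which
[T] attains [t], write [s] for the supremum of the A-norm of [T y] over the
unit vectors [y] that are A-orthogonal to [x0].  Everything turns on the gap
[s < t].

The basic fact is a first-order condition ([norming_preserves_orth]): since [T]
attains its A-norm at [x0], it sends vectors A-orthogonal to [x0] to vectors
A-orthogonal to [T x0].  Hence if [x = a x0 + y] is the A-orthogonal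
decomposition of [x], the square of the A-norm of [T x] is
[|a|^2 t^2 + ||T y||_A^2] ([pythagoras_image]).

The gap implies smoothness.  If the A-inner product [c] of [T x0] and [S x0] is
nonzero, then for a small [e > 0] the operator [T - e c S] has A-norm below [t]:
moving along [x0] gains a term of order [e], and away from [x0] the gap absorbs
the cross terms, which are of order [e] times the A-norm of [y]
([perturbation_estimate]).  So orthogonality of [T] to [S] forces [c = 0]
([norming_ortho_image]), and conversely [c = 0] makes [T] orthogonal to [S],
as evaluation at [x0] shows.  The condition [c = 0] is additive in [S].

Smoothness implies the gap.  Split [T = S1 + S2], where [S1] sends [x] to
[<x, x0>_A T x0].  As [S2] vanishes at [x0], [T] is orthogonal to [S2]; if
[s] is not below [t] then [T] is also orthogonal to [S1], because [S1] vanishes on the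
A-orthogonal complement of [x0] and [T] almost attains [t] there.  Smoothness
would make [T] orthogonal to itself, which is absurd ([gap_of_smooth]).

The description of the norming vectors in the closure of the range of [A] is a
consequence of the gap: a norming vector [a x0 + y] must have [y] of A-norm
zero by the displayed formula, so [y] is in the kernel of [A], and the kernel
meets the closure of the range only in 0.  The vector [x0] itself is the
projection of an arbitrary norming vector on the closure of the range, which
changes it only by an element of the kernel.

Most computations take place in the real part of the A-inner product, a real
semi-inner product, so that the real and the complex case are treated alike.
The identity is a positive operator, and taking it for [A] turns the results
on A-norms into results on the Hilbert norm. *)

(** * The scalar field, real or complex *)

Section Scalars.
Variables (R : realType) (k : scalar_kind).
Local Notation K := (scalars R k).
Implicit Types (z w : K) (r s : R).

Definition ofR : R -> K :=
  match k with RealScalars => idfun | ComplexScalars => real_complex R end.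

(** [|z|^2] as an element of [R]; the norm of a scalar is itself a scalar. *)
Definition abs2 z : R := sRe (z * sconj z).

Lemma sReD z w : sRe (z + w) = sRe z + sRe w.
Proof. by rewrite /sRe; case: k z w => // -[a b] [c d]. Qed.

Lemma sRe_ofRM r z : sRe (ofR r * z) = r * sRe z.
Proof.
by rewrite /sRe /ofR; case: k z => // -[a b] /=; rewrite mul0r subr0.
Qed.

Lemma ofRK r : sRe (ofR r) = r.
Proof. by rewrite /sRe /ofR; case: k. Qed.

Lemma sRe_conj z : sRe (sconj z) = sRe z.
Proof. by rewrite /sRe /sconj; case: k z => // -[]. Qed.

Lemma sconjM z w : sconj (z * w) = sconj z * sconj w.
Proof. by rewrite /sconj; case: k z w => // z w; rewrite rmorphM. Qed.

Lemma sconj_ofR r : sconj (ofR r) = ofR r.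
Proof. by rewrite /sconj /ofR; case: k => //; exact: conjc_real. Qed.

Lemma sconjN z : sconj (- z) = - sconj z.
Proof. by rewrite /sconj; case: k z => // z; rewrite rmorphN. Qed.

Lemma ofR1 : ofR 1 = 1. Proof. by rewrite /ofR; case: k. Qed.

Lemma ofRD r s : ofR (r + s) = ofR r + ofR s.
Proof. by rewrite /ofR; case: k => //; rewrite rmorphD. Qed.

Lemma ofRM r s : ofR (r * s) = ofR r * ofR s.
Proof. by rewrite /ofR; case: k => //; rewrite rmorphM. Qed.

Lemma ofRN r : ofR (- r) = - ofR r.
Proof. by rewrite /ofR; case: k => //; rewrite rmorphN. Qed.

Lemma ler_ofR r s : (ofR r <= ofR s) = (r <= s).
Proof. by rewrite /ofR; case: k => //; exact: lecR. Qed.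

Lemma ltr_ofR r s : (ofR r < ofR s) = (r < s).
Proof. by rewrite /ofR; case: k => //; exact: ltcR. Qed.

Lemma ofR0 : ofR 0 = 0. Proof. by rewrite /ofR; case: k. Qed.

Lemma sconj0 : sconj (0 : K) = 0.
Proof. by rewrite -ofR0 sconj_ofR. Qed.

Lemma ge0_ofR z : 0 <= z -> ofR (sRe z) = z.
Proof.
rewrite /ofR /sRe; case: k z => // z z0.
by apply: RRe_real; rewrite ger0_real.
Qed.

Lemma sqr_norm z : `|z| ^+ 2 = z * sconj z.
Proof.
rewrite /sconj; case: k z => [z|z] /=.
  by rewrite -normrX ger0_norm ?sqr_ge0.
by rewrite normcE sqr_sqrtc.
Qed.

Lemma mul_sconj z : z * sconj z = ofR (abs2 z).
Proof. by rewrite /abs2 ge0_ofR // -sqr_norm exprn_ge0. Qed.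

Lemma abs2_ofR r : abs2 (ofR r : K) = r ^+ 2.
Proof. by rewrite /abs2 sconj_ofR sRe_ofRM ofRK expr2. Qed.

Lemma abs2_ge0 z : 0 <= abs2 z.
Proof. by rewrite -ler_ofR -mul_sconj -sqr_norm ofR0 exprn_ge0. Qed.

Lemma abs2_eq0 z : abs2 z = 0 -> z = 0.
Proof.
move=> z0; apply/eqP; rewrite -normr_eq0 -sqrf_eq0 sqr_norm mul_sconj z0.
by rewrite ofR0.
Qed.

Lemma abs2_eq1 z : abs2 z = 1 <-> `|z| = 1.
Proof.
split=> [z1|z1]; last by rewrite /abs2 -sqr_norm z1 expr1n -ofR1 ofRK.
by apply/eqP; rewrite -(@pexpr_eq1 _ _ 2) // sqr_norm mul_sconj z1 ofR1.
Qed.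

End Scalars.
Arguments ofR {R k}.

(** * The A-inner product as a real semi-inner product *)

Lemma discriminant_le0 (R : realType) (a b c : R) : 0 <= c ->
  (forall r, 0 <= a + 2 * r * b + r ^+ 2 * c) -> b ^+ 2 <= a * c.
Proof.
rewrite le_eqVlt => /orP[/eqP <-|c0] h.
  have [->|b0] := eqVneq b 0; first by rewrite mulr0 expr0n.
  (* A nonconstant affine function is negative somewhere; here it is -1. *)
  have := h (- (a + 1) / (2 * b)).
  rewrite mulr0 addr0.
  have -> : a + 2 * (- (a + 1) / (2 * b)) * b = -1 by field.
  by rewrite ler0N1.
(* The minimum of the quadratic. *)
have := h (- b / c).
have -> : a + 2 * (- b / c) * b + (- b / c) ^+ 2 * c = (a * c - b ^+ 2) / c.
  by field; rewrite gt_eqF.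
by rewrite pmulr_lge0 ?invr_gt0 // subr_ge0.
Qed.

Section Form.
Variables (R : realType) (k : scalar_kind) (H : hilbertType R k).
Local Notation K := (scalars R k).
Variable A : {linear H -> H}.
Hypothesis A_pos : positive_operator A.
Implicit Types (x y z : H) (a : K) (r : R).

(** Symmetric and real bilinear whichever the scalar field is, so that arguments
with real quadratic polynomials apply to it. *)
Definition reA x y : R := sRe (innerA A x y).
Definition qA x : R := reA x x.

Lemma innerC x y : inner H x y = sconj (inner H y x).
Proof. by rewrite [LHS]hermitian_subproof expr0 mul1r. Qed.

Lemma innerADl x y z : innerA A (x + y) z = innerA A x z + innerA A y z.
Proof. by rewrite /innerA !linearD linearDl. Qed.

Lemma innerAZl a x y : innerA A (a *: x) y = a * innerA A x y.
Proof. by rewrite /innerA linearZ /= linearZl_LR. Qed.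

Lemma innerAC x y : innerA A x y = sconj (innerA A y x).
Proof. by rewrite /innerA -innerC; have [_ ->] := A_pos. Qed.

Lemma innerA_ge0 x : 0 <= innerA A x x.
Proof. by have [_ _] := A_pos; apply. Qed.

Lemma innerADr x y z : innerA A x (y + z) = innerA A x y + innerA A x z.
Proof. by rewrite /innerA linearDr. Qed.

Lemma innerAZr a x y : innerA A x (a *: y) = sconj a * innerA A x y.
Proof. by rewrite innerAC innerAZl sconjM -innerAC. Qed.

Lemma reAC x y : reA x y = reA y x.
Proof. by rewrite /reA innerAC sRe_conj. Qed.

Lemma reADl x y z : reA (x + y) z = reA x z + reA y z.
Proof. by rewrite /reA innerADl sReD. Qed.

Lemma reADr x y z : reA x (y + z) = reA x y + reA x z.
Proof. by rewrite reAC reADl !(reAC x). Qed.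

Lemma reAZl r x y : reA (ofR r *: x) y = r * reA x y.
Proof. by rewrite /reA innerAZl sRe_ofRM. Qed.

Lemma reAZr r x y : reA x (ofR r *: y) = r * reA x y.
Proof. by rewrite reAC reAZl reAC. Qed.

Lemma reAZ2 a x y : reA (a *: x) (a *: y) = abs2 a * reA x y.
Proof. by rewrite /reA innerAZl innerAZr mulrA mul_sconj sRe_ofRM. Qed.

Lemma qAZ a x : qA (a *: x) = abs2 a * qA x.
Proof. exact: reAZ2. Qed.

Lemma qA_ge0 x : 0 <= qA x.
Proof. by rewrite -(ler_ofR k) ofR0 ge0_ofR; exact: innerA_ge0. Qed.

Lemma normA_sqr x : normA A x ^+ 2 = qA x.
Proof. by rewrite sqr_sqrtr // qA_ge0. Qed.

Lemma innerA_self x : innerA A x x = ofR (qA x).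
Proof. by rewrite /qA /reA ge0_ofR ?innerA_ge0. Qed.

Lemma qADZ x y r : qA (x + ofR r *: y) = qA x + 2 * r * reA x y + r ^+ 2 * qA y.
Proof. by rewrite /qA !(reADl, reADr) !(reAZl, reAZr) (reAC y x); ring. Qed.

Lemma qAD x y : qA (x + y) = qA x + 2 * reA x y + qA y.
Proof. by rewrite /qA !(reADl, reADr) (reAC y x); ring. Qed.

Lemma cauchy_schwarz x y : reA x y ^+ 2 <= qA x * qA y.
Proof. by apply: discriminant_le0 => [|r]; rewrite -?qADZ qA_ge0. Qed.

End Form.

(** * A-norms of vectors and operators *)

(** Holds for every set, as the supremum of an unbounded or empty set is 0. *)
Lemma sup_ge0 (R : realType) (E : set R) :
  (forall x, E x -> 0 <= x) -> 0 <= sup E.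
Proof.
move=> E0; have [[[x Ex] bE]|/sup_out -> //] := pselect (has_sup E).
exact: le_trans (E0 _ Ex) (ub_le_sup bE Ex).
Qed.

Section SemiNorm.
Variables (R : realType) (k : scalar_kind) (H : hilbertType R k).
Local Notation K := (scalars R k).
Variable A : {linear H -> H}.
Hypothesis A_pos : positive_operator A.
Implicit Types (x y z : H) (a : K) (r : R).
Local Notation re := (reA A).
Local Notation q := (qA A).

Lemma normA_ge0 x : 0 <= normA A x.
Proof. exact: sqrtr_ge0. Qed.

Lemma normA_eq1 x : normA A x = 1 <-> q x = 1.
Proof.
rewrite -(normA_sqr A_pos); split=> [->|/eqP]; first by rewrite expr1n.
by rewrite pexpr_eq1 ?normA_ge0 // => /eqP.
Qed.

Lemma normA_le x (M : R) : 0 <= M -> (normA A x <= M) = (q x <= M ^+ 2).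
Proof.
by move=> M0; rewrite -(normA_sqr A_pos) ler_pXn2r // nnegrE normA_ge0.
Qed.

Lemma qA_add_le x y : q (x + y) <= 2 * q x + 2 * q y.
Proof.
have := qA_ge0 A_pos (x + ofR (-1) *: y).
by rewrite (qADZ A_pos) (qAD A_pos); lra.
Qed.

Lemma normA_boundP (F : H -> H) :
  (exists c : R, 0 < c /\ forall x, normA A (F x) <= c * normA A x) <->
  (exists c : R, forall x, q (F x) <= c * q x).
Proof.
split=> [[c [c0 Fc]]|[c Fc]].
  exists (c ^+ 2) => x; rewrite -!(normA_sqr A_pos) -exprMn.
  by rewrite ler_pXn2r // nnegrE ?mulr_ge0 ?normA_ge0 // ltW.
(* The square of |c| + 1 exceeds c. *)
exists (`|c| + 1); have c0 := normr_ge0 c; split; first by lra.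
move=> x; have x0 := normA_ge0 x.
have M0 : 0 <= (`|c| + 1) * normA A x by rewrite mulr_ge0 //; lra.
rewrite normA_le //.
apply: le_trans (Fc x) _; rewrite exprMn (normA_sqr A_pos).
apply: ler_wpM2r; first exact: qA_ge0.
by have := ler_norm c; have := sqr_ge0 `|c|; rewrite !expr2; lra.
Qed.

Lemma normalize x : 0 < q x -> q (ofR (Num.sqrt (q x))^-1 *: x) = 1.
Proof.
move=> qx.
rewrite (qAZ A_pos) abs2_ofR exprVn sqr_sqrtr ?ltW //.
by rewrite mulVf // gt_eqF.
Qed.

(** The difference is the component of [x] that is A-orthogonal to [x0]. *)
Lemma innerA_rejection x0 x : q x0 = 1 ->
  innerA A x0 (x - innerA A x x0 *: x0) = 0.
Proof.
move=> x01; rewrite -scaleNr (innerADr A) (innerAZr A_pos).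
rewrite (innerA_self A_pos) x01 ofR1 mulr1 (innerAC A_pos x0).
by rewrite sconjN addrN.
Qed.

Lemma pythagoras x0 x : q x0 = 1 ->
  q x = abs2 (innerA A x x0) + q (x - innerA A x x0 *: x0).
Proof.
move=> x01; have orth := innerA_rejection x x01.
set a := innerA A x x0 in orth *.
have re0 : re (a *: x0) (x - a *: x0) = 0.
  by rewrite /reA (innerAZl A) orth mulr0 -[0 in LHS]ofR0 ofRK.
have := qAD A_pos (a *: x0) (x - a *: x0).
by rewrite addrC subrK re0 mulr0 addr0 (qAZ A_pos) x01 mulr1.
Qed.

Lemma bessel x0 x : q x0 = 1 -> abs2 (innerA A x x0) <= q x.
Proof. by move=> x01; rewrite (pythagoras x x01) lerDl (qA_ge0 A_pos). Qed.

Lemma reA_eq0 x y : innerA A x y = 0 -> re x y = 0.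
Proof. by rewrite /reA => ->; rewrite -[0 in LHS]ofR0 ofRK. Qed.

Section Op.
Variable T : {linear H -> H}.
Hypothesis T_bnd : A_bounded A T.

Lemma A_bounded_qA : exists c : R, forall x, q (T x) <= c * q x.
Proof. by apply/normA_boundP; case: T_bnd. Qed.

Lemma normA_le_opnormA x : normA A x = 1 -> normA A (T x) <= opnormA A T.
Proof.
move=> x1; apply: ub_le_sup; last by exists x.
have [_ [c [c0 Tc]]] := T_bnd; exists c => _ [y y1 <-].
by rewrite -(mulr1 c) -y1.
Qed.

Lemma opnormA_ge0 : 0 <= opnormA A T.
Proof. by apply: sup_ge0 => _ [y _ <-]; exact: normA_ge0. Qed.

(** For a vector that can be normalized this is homogeneity.  A vector of A-norm
zero needs the A-boundedness of [T], which gives [T x] the A-norm zero. *)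
Lemma qA_image_le_opnormA x : q (T x) <= opnormA A T ^+ 2 * q x.
Proof.
have := qA_ge0 A_pos x; rewrite le_eqVlt => /orP[/eqP x0|x0].
  by have [c /(_ x)] := A_bounded_qA; rewrite -x0 !mulr0.
have := normalize x0; set a := ofR _ => ax1.
have := ax1; rewrite -normA_eq1 => /normA_le_opnormA.
rewrite normA_le ?opnormA_ge0 // linearZ /= (qAZ A_pos) => le.
rewrite (qAZ A_pos) in ax1.
rewrite -[leLHS]mul1r -ax1.
by have := ler_wpM2r (ltW x0) le; congr (_ <= _); ring.
Qed.

Lemma sup_orthA_ge0 x0 : 0 <= sup_orthA A T x0.
Proof. by apply: sup_ge0 => _ [y _ <-]; exact: normA_ge0. Qed.

Lemma qA_image_le_sup_orthA x0 y : innerA A x0 y = 0 ->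
  q (T y) <= sup_orthA A T x0 ^+ 2 * q y.
Proof.
move=> x0y; have := qA_ge0 A_pos y; rewrite le_eqVlt => /orP[/eqP y0|y0].
  by have [c /(_ y)] := A_bounded_qA; rewrite -y0 !mulr0.
have := normalize y0; set a := ofR _ => ay1.
have : normA A (T (a *: y)) <= sup_orthA A T x0.
  apply: ub_le_sup.
    exists (opnormA A T) => _ [z [_ z1] <-]; exact: normA_le_opnormA.
  exists (a *: y) => //; split; last by rewrite normA_eq1.
  by rewrite (innerAZr A_pos) x0y mulr0.
rewrite normA_le ?sup_orthA_ge0 // linearZ /= (qAZ A_pos) => le.
rewrite (qAZ A_pos) in ay1.
rewrite -[leLHS]mul1r -ay1.
by have := ler_wpM2r (ltW y0) le; congr (_ <= _); ring.
Qed.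

End Op.

Lemma opnormA_le (F : H -> H) (M : R) : 0 <= M ->
  (forall x, q x = 1 -> q (F x) <= M ^+ 2) -> opnormA A F <= M.
Proof.
move=> M0 FM; rewrite /opnormA.
set E := (X in sup X); have [->|/set0P ne] := eqVneq E set0.
  by rewrite sup0.
by apply: ge_sup => // _ [x /= x1 <-]; rewrite normA_le // FM // -normA_eq1.
Qed.

(** First-order condition: the nonnegative function
[r |-> t * q (u + r y) - q (T (u + r y))] vanishes at [r = 0], so its linear
coefficient, a multiple of [re (T u) (T y)], is zero. *)
Lemma norming_preserves_orth (T : {linear H -> H}) (t : R) u y :
  (forall x, q (T x) <= t * q x) -> q (T u) = t * q u -> re u y = 0 ->
  re (T u) (T y) = 0.
Proof.
move=> Tt Tu uy.
have d0 : 0 <= t * q y - q (T y) by rewrite subr_ge0.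
have : re (T u) (T y) ^+ 2 <= 0 * (t * q y - q (T y)).
  rewrite -sqrrN; apply: discriminant_le0 => // r.
  have := Tt (u + ofR r *: y).
  by rewrite linearD linearZ /= !(qADZ A_pos) uy Tu; lra.
by rewrite mul0r => le0; apply/eqP; rewrite -sqrf_eq0 eq_le le0 sqr_ge0.
Qed.

End SemiNorm.

(** * Projection on the closure of a range *)

Lemma sqr_sub_le (R : realType) (a b c r : R) :
  a ^+ 2 <= c -> b ^+ 2 <= c -> 4 * c <= r -> (a + -1 * b) ^+ 2 <= r.
Proof. by have := sqr_ge0 (a + b); rewrite !expr2; lra. Qed.

Section Projection.
Variables (R : realType) (k : scalar_kind) (H : hilbertType R k).
Local Notation K := (scalars R k).
Implicit Types (x y z : H) (a : K) (r : R).

Lemma id_positive : positive_operator (idfun : H -> H).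
Proof.
split=> [||x] //; first by exists 1; split=> [|x]; rewrite ?ltr01 ?mul1r.
by rewrite -hilbert_normE exprn_ge0.
Qed.

Local Notation I := (idfun : {linear H -> H}).
Local Notation sq := (qA I).
Local Notation dt := (reA I).

Lemma sqr_normE x : `|x| ^+ 2 = ofR (sq x).
Proof. by rewrite hilbert_normE; exact: (innerA_self id_positive). Qed.

Lemma norm_normA x : `|x| = ofR (normA I x).
Proof.
apply/eqP; rewrite -(@eqrXn2 _ 2) ?normr_ge0 //; last first.
  by rewrite -ofR0 ler_ofR normA_ge0.
by rewrite sqr_normE expr2 -ofRM -expr2 (normA_sqr id_positive).
Qed.

Lemma norm_lt_ofR x (e : R) : 0 < e -> (`|x| < ofR e) = (sq x < e ^+ 2).
Proof.
move=> e0; rewrite norm_normA ltr_ofR -(normA_sqr id_positive).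
by rewrite ltr_pXn2r // nnegrE ?normA_ge0 // ltW.
Qed.

Lemma norm_eq0_of_qA x : sq x = 0 -> x = 0.
Proof.
by move=> x0; apply/eqP; rewrite -normr_eq0 -sqrf_eq0 sqr_normE x0 ofR0.
Qed.

Lemma gt0_ofR (e : K) : 0 < e -> exists2 r : R, 0 < r & e = ofR r.
Proof.
move=> e0; exists (sRe e); last by rewrite ge0_ofR // ltW.
by rewrite -(ltr_ofR k) ofR0 ge0_ofR // ltW.
Qed.

(** Completeness restated with real epsilons and squared norms; the norm takes
its values in the scalar field, which need not be real. *)
Lemma seq_complete (v : nat -> H) :
  (forall e : R, 0 < e -> exists N, forall n, (N <= n)%N -> sq (v N - v n) < e) ->
  exists2 p, closure (range v) p &
    forall e : R, 0 < e -> exists N, forall n, (N <= n)%N -> sq (p - v n) < e.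
Proof.
move=> cv.
have cauv : cauchy (v @ \oo).
  apply: cauchy_exP => e /gt0_ofR[r r0 ->].
  have [N vN] := cv (r ^+ 2) ltac:(by rewrite exprn_gt0).
  exists (v N); exists N => // n /= Nn.
  by rewrite -ball_normE /= norm_lt_ofR // vN.
pose p := lim (v @ \oo).
have vp : v @ \oo --> p by exact: cauchy_cvg.
exists p.
  apply: (closed_cvg (fun y => closure (range v) y) _ _ _ vp).
    exact: closed_closure.
  by apply: nearW => n; apply: subset_closure; exists n.
move=> e e0.
have s0 : 0 < Num.sqrt e by rewrite sqrtr_gt0.
have s0' : (0 : K) < ofR (Num.sqrt e) by rewrite -ofR0 ltr_ofR.
have [N _ vN] := (cvgrPdist_lt _ _).1 vp _ s0'.
exists N => n Nn; rewrite -[e]sqr_sqrtr ?ltW // -norm_lt_ofR //.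
exact: vN.
Qed.

(** A minimizing sequence for the distance from [x] to the range of [V] is
Cauchy by the parallelogram law.  Orthogonality holds approximately along the
sequence, because perturbing a near-minimizer in the direction of [V y] cannot
reduce the squared distance by more than [e n], and it passes to the limit. *)
Lemma projection (V : {linear H -> H}) x :
  exists2 p, closure (range V) p & forall y, dt (x - p) (V y) = 0.
Proof.
pose D : set R := [set sq (x - V y) | y in [set: H]].
have D_inf : has_inf D.
  split; first by exists (sq (x - V 0)); exists 0.
  by exists 0 => _ [y _ <-]; rewrite (qA_ge0 id_positive).
pose e n : R := n.+1%:R^-1.
have e_gt0 n : 0 < e n by rewrite invr_gt0 ltr0n.
have e_le m n : (m <= n)%N -> e n <= e m.
  by move=> mn; rewrite lef_pV2 ?posrE ?ltr0n // ler_nat ltnS.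
have e_small r : 0 < r -> exists N, e N < r.
  move=> r0; have [N _ /(_ N (leqnn N))] := near_infty_natSinv_lt (PosNum r0).
  by exists N.
have inf_le y : inf D <= sq (x - V y).
  by apply: ge_inf; [case: D_inf | exists y].
have /choice[w wP] n : exists y, sq (x - V y) < inf D + e n.
  by have [_ [y _ <-] ylt] := inf_adherent (e_gt0 n) D_inf; exists y.
have par m n : sq (V (w m) - V (w n)) <= 2 * e m + 2 * e n.
  pose u := x - V (w m); pose v := x - V (w n).
  have -> : V (w m) - V (w n) = v + ofR (- 1) *: u.
    by rewrite /u /v ofRN ofR1 scaleN1r opprB [RHS]addrC addrA subrK.
  (* The midpoint of [V (w m)] and [V (w n)] is in the range. *)
  have := inf_le (ofR (2^-1) *: (w m + w n)).
  have -> : x - V (ofR 2^-1 *: (w m + w n)) = ofR 2^-1 *: (u + ofR 1 *: v).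
    rewrite ofR1 scale1r /u /v linearZ /= linearD addrACA -opprD scalerBr.
    have half : 2^-1 + 2^-1 = 1 :> R by field.
    by rewrite [in RHS](scalerDr _ x x) -scalerDl -ofRD half ofR1 scale1r.
  have := wP m; have := wP n; rewrite -/u -/v.
  rewrite (qAZ id_positive) !(qADZ id_positive) abs2_ofR (reAC id_positive v u).
  by lra.
have [r r0|p pcl vp] := @seq_complete (V \o w).
  have [N eN] := e_small (r / 4) ltac:(by rewrite divr_gt0).
  exists N => n Nn; apply: le_lt_trans (par _ _) _.
  by have := e_le _ _ Nn; lra.
exists p; first by apply: closure_subset pcl => _ [n _ <-]; exists (w n).
move=> y.
have near_orth n : dt (x - V (w n)) (V y) ^+ 2 <= e n * sq (V y).
  apply: (discriminant_le0 (qA_ge0 id_positive _)) => r.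
  have := inf_le (w n - ofR r *: y).
  have := wP n.
  have -> : x - V (w n - ofR r *: y) = (x - V (w n)) + ofR r *: V y.
    by rewrite linearB linearZ /= opprB addrCA addrC.
  by rewrite (qADZ id_positive); lra.
apply/eqP; rewrite -sqrf_eq0 eq_le sqr_ge0 andbT.
apply/ler_addgt0Pr => r r0; rewrite add0r.
pose d := r / (4 * (sq (V y) + 1)).
have Q0 := qA_ge0 id_positive (V y).
have d0 : 0 < d by rewrite divr_gt0 // mulr_gt0 //; lra.
have dQ : 4 * (d * sq (V y)) <= r.
  have -> : r = 4 * (d * (sq (V y) + 1)) by rewrite /d; field; lra.
  by rewrite !ler_pM2l //; lra.
have [N1 eN] := e_small d d0; have [N2 /(_ (maxn N1 N2))] := vp d d0.
move=> /(_ (leq_maxr _ _)); set n := maxn N1 N2 => pn.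
have en : e n < d by apply: le_lt_trans (e_le _ _ (leq_maxl _ _)) eN.
have h1 : dt (x - V (w n)) (V y) ^+ 2 <= d * sq (V y).
  by apply: le_trans (near_orth n) _; rewrite ler_wpM2r // ltW.
have h2 : dt (p - V (w n)) (V y) ^+ 2 <= d * sq (V y).
  apply: le_trans (cauchy_schwarz id_positive _ _) _.
  by rewrite ler_wpM2r // ltW.
have -> : x - p = (x - V (w n)) + ofR (- 1) *: (p - V (w n)).
  by rewrite ofRN ofR1 scaleN1r opprB addrA subrK.
rewrite (reADl I) (reAZl I).
exact: sqr_sub_le h1 h2 dQ.
Qed.

End Projection.

(** * The kernel of A and A-bounded operators *)

Section Kernel.
Variables (R : realType) (k : scalar_kind) (H : hilbertType R k).
Local Notation K := (scalars R k).
Variable A : {linear H -> H}.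
Hypothesis A_pos : positive_operator A.
Implicit Types (x y z : H) (a : K) (r : R).
Local Notation q := (qA A).

Lemma qA_eq0 x : q x = 0 -> A x = 0.
Proof.
move=> x0; apply: norm_eq0_of_qA; apply/eqP.
rewrite -sqrf_eq0 eq_le sqr_ge0 andbT.
rewrite -(mul0r (q (A x))) -x0.
exact: (cauchy_schwarz A_pos x (A x)).
Qed.

Lemma qA_ker x : A x = 0 -> q x = 0.
Proof.
by rewrite /qA /reA /innerA => ->; rewrite linear0l -[0 in LHS]ofR0 ofRK.
Qed.

Lemma qA_subker x y : A (x - y) = 0 -> q x = q y.
Proof.
rewrite linearB => /eqP; rewrite subr_eq0 => /eqP e.
rewrite /qA /reA {1}/innerA e -/(innerA A y x) (innerAC A_pos) sRe_conj.
by rewrite /innerA e.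
Qed.

End Kernel.

Section ABounded.
Variables (R : realType) (k : scalar_kind) (H : hilbertType R k).
Local Notation K := (scalars R k).
Variable A : {linear H -> H}.
Hypothesis A_pos : positive_operator A.
Implicit Types (x y z : H) (a : K) (r : R).
Local Notation re := (reA A).
Local Notation q := (qA A).
Local Notation I := (idfun : {linear H -> H}).
Local Notation sq := (qA I).
Local Notation dt := (reA I).

Lemma bounded_operatorP (F : H -> H) :
  bounded_operator F <-> exists c : R, forall x, sq (F x) <= c * sq x.
Proof.
rewrite -(normA_boundP (id_positive H)); split=> -[c [c0 Fc]].
  have [r r0 er] := gt0_ofR c0; exists r; split=> // x.
  by have := Fc x; rewrite er !norm_normA -ofRM ler_ofR.
exists (ofR c); split; first by rewrite -ofR0 ltr_ofR.
by move=> x; rewrite !norm_normA -ofRM ler_ofR.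
Qed.

Lemma A_boundedP (F : H -> H) : A_bounded A F <->
  (exists c : R, forall x, sq (F x) <= c * sq x) /\
  (exists c : R, forall x, q (F x) <= c * q x).
Proof. by rewrite /A_bounded bounded_operatorP (normA_boundP A_pos). Qed.

Lemma closure_rangeP (V : {linear H -> H}) x :
  closure (range V) x <-> forall e : R, 0 < e -> exists z, sq (x - V z) < e.
Proof.
split=> [cl e e0|cl B /nbhs_ballP[_ /gt0_ofR[e e0 ->] eB]].
  have s0 : 0 < Num.sqrt e by rewrite sqrtr_gt0.
  have s0' : (0 : K) < ofR (Num.sqrt e) by rewrite -ofR0 ltr_ofR.
  have [_ [[z _ <-]]] := cl _ (nbhsx_ballx x _ s0').
  by rewrite -ball_normE /= norm_lt_ofR // sqr_sqrtr ?ltW // => ?; exists z.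
have [z zlt] := cl (e ^+ 2) ltac:(by rewrite exprn_gt0).
exists (V z); split; first by exists z.
by apply: eB; rewrite -ball_normE /= norm_lt_ofR.
Qed.

Lemma closure_range_linear (V : {linear H -> H}) a x y :
  closure (range V) x -> closure (range V) y -> closure (range V) (a *: x + y).
Proof.
move=> /closure_rangeP xV /closure_rangeP yV; apply/closure_rangeP => e e0.
have a0 := abs2_ge0 a; set b := abs2 a in a0.
have d0 : 0 < e / (4 * (b + 1)) by rewrite divr_gt0 // mulr_gt0 //; lra.
have [z zx] := xV _ d0; have [w wy] := yV (e / 4) ltac:(by rewrite divr_gt0).
exists (a *: z + w).
have -> : a *: x + y - V (a *: z + w) = a *: (x - V z) + (y - V w).
  by rewrite linearP scalerBr opprD addrACA.
apply: le_lt_trans (qA_add_le (id_positive H) _ _) _.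
rewrite (qAZ (id_positive H)) -/b.
have : b * sq (x - V z) <= b * (e / (4 * (b + 1))) by rewrite ler_wpM2l // ltW.
have : b * (e / (4 * (b + 1))) <= e / 4.
  have -> : e / 4 = (b + 1) * (e / (4 * (b + 1))) by field; lra.
  by rewrite ler_pM2r //; lra.
by lra.
Qed.

Lemma A_adjoint x y : dt (A x) y = dt x (A y).
Proof.
by have [_ Asym _] := A_pos; rewrite /reA /innerA; congr sRe; exact: Asym.
Qed.

(** Such an [x] is orthogonal to the range, so [x - A z] is at least as long as
[x], whereas it can be made arbitrarily short. *)
Lemma ker_closure_range x : A x = 0 -> closure (range A) x -> x = 0.
Proof.
move=> Ax0 /closure_rangeP xA; apply: norm_eq0_of_qA.
apply/eqP; rewrite eq_le (qA_ge0 (id_positive H)) andbT.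
apply/ler_addgt0Pr => e e0; rewrite add0r.
have [z zlt] := xA _ e0; apply: le_trans (ltW zlt).
have -> : x - A z = x + ofR (- 1) *: A z by rewrite ofRN ofR1 scaleN1r.
rewrite (qADZ (id_positive H)) -A_adjoint Ax0.
have -> : dt 0 z = 0 by rewrite /reA /innerA linear0l -[0 in LHS]ofR0 ofRK.
by have := qA_ge0 (id_positive H) (A z); lra.
Qed.

(** The remainder [x - p] is orthogonal to the range of the self-adjoint [A], so
[A] kills it. *)
Lemma projection_ker x : exists2 p, closure (range A) p & A (x - p) = 0.
Proof.
have [p pcl px] := projection A x; exists p => //; apply: norm_eq0_of_qA.
by rewrite /qA A_adjoint px.
Qed.

Definition rank_one x0 v : H -> H := fun x => innerA A x x0 *: v.

Lemma rank_one_linear x0 v : linear (rank_one x0 v).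
Proof.
by move=> a x y; rewrite /rank_one (innerADl A) (innerAZl A) scalerDl scalerA.
Qed.
HB.instance Definition _ x0 v :=
  GRing.isLinear.Build K H H _ (rank_one x0 v) (rank_one_linear x0 v).

(** Cauchy-Schwarz for the Hilbert inner product of [A x] and [x]. *)
Lemma qA_le_norm : exists c, forall x, q x <= c * sq x.
Proof.
have [bA _ _] := A_pos; have [c Ac] := (bounded_operatorP A).1 bA.
exists (`|c| + 1) => x.
have x0 := qA_ge0 (id_positive H) x.
have := cauchy_schwarz (id_positive H) (A x) x; rewrite -[dt (A x) x]/(q x).
have : sq (A x) * sq x <= `|c| * sq x ^+ 2.
  rewrite expr2 mulrA ler_wpM2r //; apply: le_trans (Ac x) _.
  by rewrite ler_wpM2r // ler_norm.
have c0 := normr_ge0 c => h1 h2.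
rewrite -(@ler_pXn2r _ 2) // ?nnegrE ?mulr_ge0 ?(qA_ge0 A_pos) ?addr_ge0 //.
rewrite exprMn; apply: le_trans h2 (le_trans h1 _).
apply: ler_wpM2r; first exact: sqr_ge0.
by have := sqr_ge0 `|c|; rewrite !expr2; lra.
Qed.

Lemma A_bounded_rank_one x0 v : q x0 = 1 -> A_bounded A (rank_one x0 v).
Proof.
move=> x01; apply/A_boundedP; split.
  have [c qc] := qA_le_norm; exists (c * sq v) => x.
  rewrite (qAZ (id_positive H)).
  rewrite mulrAC ler_wpM2r ?(qA_ge0 (id_positive H)) //.
  exact: le_trans (bessel A_pos x x01) _.
exists (q v) => x; rewrite (qAZ A_pos) mulrC ler_wpM2l ?qA_ge0 //.
exact: bessel.
Qed.

Lemma A_boundedD (T S : {linear H -> H}) a : A_bounded A T -> A_bounded A S ->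
  A_bounded A (fun x => T x + a *: S x).
Proof.
move=> /A_boundedP[[c1 h1] [c2 h2]] /A_boundedP[[d1 g1] [d2 g2]].
apply/A_boundedP; split.
  exists (2 * c1 + 2 * (abs2 a * d1)) => x.
  apply: le_trans (qA_add_le (id_positive H) _ _) _.
  rewrite (qAZ (id_positive H)).
  by have := h1 x; have := ler_wpM2l (abs2_ge0 a) (g1 x); lra.
exists (2 * c2 + 2 * (abs2 a * d2)) => x.
apply: le_trans (qA_add_le A_pos _ _) _; rewrite (qAZ A_pos).
by have := h2 x; have := ler_wpM2l (abs2_ge0 a) (g2 x); lra.
Qed.

(** Bundled as a linear map, so that results on linear maps apply to it. *)
Definition perturb (T : {linear H -> H}) a (S : {linear H -> H}) :
   {linear H -> H} := T \+ a \*: S.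

Lemma normA_le_perturb (T S : {linear H -> H}) a x :
  A_bounded A T -> A_bounded A S -> normA A x = 1 ->
  normA A (T x + a *: S x) <= opnormA A (fun x => T x + a *: S x).
Proof.
move=> bT bS x1.
exact: (normA_le_opnormA (T := perturb T a S) (A_boundedD _ bT bS)).
Qed.

End ABounded.

(** * The gap and smoothness *)

Lemma young_bound (R : realType) (e L E n w : R) : 0 < L -> w ^+ 2 <= E * n ->
  - 2 * e * w <= e ^+ 2 * L + E * n / L.
Proof.
move=> L0 wE.
have : w ^+ 2 / L <= E * n / L by rewrite ler_pM2r ?invr_gt0.
have : 0 <= (e * L + w) ^+ 2 / L by rewrite divr_ge0 ?sqr_ge0 ?ltW.
have -> : (e * L + w) ^+ 2 / L = e ^+ 2 * L + 2 * e * w + w ^+ 2 / L.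
  by field; rewrite gt_eqF.
by lra.
Qed.

(** The left-hand side bounds the square of the A-norm of [T x - e U x] for a
unit vector [x] whose component off [x0] has square [n], where [t2] and [s2] are the
squares of [t] and [s], [w1] and [w2] are cross terms, [g] is the real A-inner
product of [T x0] and [U x0], and [D] bounds [U].  The slack [(t2 - s2) * n]
absorbs the terms of order [e * sqrt n] after completing the square; uniformity
of [e] in [n] is what makes the supremum over [x] drop strictly. *)
Lemma perturbation_estimate (R : realType) (t2 s2 g D E : R) :
  s2 < t2 -> 0 < g -> 0 <= D -> 0 <= E ->
  exists2 e : R, 0 < e & forall n w1 w2, 0 <= n ->
    w1 ^+ 2 <= E * n -> w2 ^+ 2 <= E * n ->
    t2 * (1 - n) + s2 * n - 2 * e * ((1 - n) * g + w1 + w2) + e ^+ 2 * D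
      <= t2 - e * g.
Proof.
move=> st g0 D0 E0; pose d := t2 - s2.
have d0 : 0 < d by rewrite subr_gt0.
(* L is so large that each cross term costs a quarter of the slack d * n. *)
pose L := 4 * (E + 1) / d.
have L0 : 0 < L by rewrite divr_gt0 // mulr_gt0 //; lra.
have EL : E / L <= d / 4.
  rewrite ler_pdivrMr // /L.
  have -> : d / 4 * (4 * (E + 1) / d) = E + 1 by field; rewrite gt_eqF.
  by lra.
have B0 : 0 <= d * (D + 2 * L).
  by apply: mulr_ge0; [exact: ltW | lra].
(* P is chosen for both bounds e1 and e2 below. *)
pose P := 4 * g ^+ 2 + d * (D + 2 * L).
have g2 : 0 < g ^+ 2 by rewrite exprn_gt0.
have P0 : 0 < P by rewrite /P; lra.
pose e := g * d / P.
have e0 : 0 < e by rewrite divr_gt0 // mulr_gt0.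
have e1 : 4 * e * g <= d.
  have -> : 4 * e * g = (4 * g ^+ 2) * d / P by rewrite /e; field; rewrite gt_eqF.
  by rewrite ler_pdivrMr // mulrC ler_pM2l // /P; lra.
have e2 : e * (D + 2 * L) <= g.
  have -> : e * (D + 2 * L) = g * (d * (D + 2 * L)) / P.
    by rewrite /e; field; rewrite gt_eqF.
  by rewrite ler_pdivrMr // ler_pM2l // /P; lra.
exists e => // n w1 w2 n0 w1E w2E.
have y1 := young_bound e L0 w1E; have y2 := young_bound e L0 w2E.
have b1 : E * n / L <= d / 4 * n by rewrite mulrAC ler_wpM2r.
have b2 : n * (4 * e * g) <= n * d by rewrite ler_wpM2l.
have b3 : e * (e * (D + 2 * L)) <= e * g by rewrite ler_pM2l.
rewrite /d in b1 b2; lra.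
Qed.

Section Gap.
Variables (R : realType) (k : scalar_kind) (H : hilbertType R k).
Local Notation K := (scalars R k).
Variable A : {linear H -> H}.
Hypothesis A_pos : positive_operator A.
Variable T : {linear H -> H}.
Hypothesis T_bnd : A_bounded A T.
Implicit Types (x y z : H) (a : K) (r : R).
Local Notation re := (reA A).
Local Notation q := (qA A).
Local Notation t := (opnormA A T).
Local Notation s x0 := (sup_orthA A T x0).

Lemma orthoA_of_vector (S : {linear H -> H}) x : A_bounded A S ->
  normingA A T x -> innerA A (T x) (S x) = 0 -> orthoA A T S.
Proof.
move=> S_bnd [x1 Tx] orth l.
apply: le_trans (normA_le_perturb A_pos l T_bnd S_bnd x1).
rewrite -Tx (normA_le A_pos) ?normA_ge0 // (normA_sqr A_pos) (qAD A_pos).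
rewrite (reA_eq0 (y := l *: S x)); last by rewrite (innerAZr A_pos) orth mulr0.
by have := qA_ge0 A_pos (l *: S x); lra.
Qed.

(** Adding a multiple of [S] does not change [T] on the A-orthogonal complement
of [x0]. *)
Lemma sup_orthA_le_perturb (S : {linear H -> H}) x0 l : A_bounded A S ->
  (forall y, innerA A x0 y = 0 -> S y = 0) ->
  s x0 <= opnormA A (fun x => T x + l *: S x).
Proof.
move=> S_bnd S0; rewrite /sup_orthA.
set E := (X in sup X).
have [->|/set0P ne] := eqVneq E set0.
  by rewrite sup0; exact: (opnormA_ge0 A (perturb T l S)).
apply: ge_sup => // _ [y [x0y y1] <-].
have := normA_le_perturb A_pos l T_bnd S_bnd y1.
by rewrite S0 // scaler0 addr0.
Qed.

Lemma pythagoras_image x0 x : normingA A T x0 ->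
  let a := innerA A x x0 in
  q (T x) = abs2 a * t ^+ 2 + q (T (x - a *: x0)).
Proof.
move=> [/(normA_eq1 A_pos) x01 Tx0] a.
have qTx0 : q (T x0) = t ^+ 2 by rewrite -Tx0 normA_sqr.
have orth : re (T (a *: x0)) (T (x - a *: x0)) = 0.
  apply: (norming_preserves_orth A_pos (qA_image_le_opnormA A_pos T_bnd)).
    by rewrite linearZ /= !(qAZ A_pos) qTx0 x01; ring.
  by apply: reA_eq0; rewrite (innerAZl A) (innerA_rejection A_pos _ x01) mulr0.
have := qAD A_pos (T (a *: x0)) (T (x - a *: x0)).
rewrite -linearD addrC subrK orth mulr0 addr0 => ->.
by rewrite linearZ /= (qAZ A_pos) qTx0.
Qed.

(** If the A-inner product [c] were nonzero, a small step against [c *: S] would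
decrease the A-norm of [T]. *)
Lemma norming_ortho_image x0 (S : {linear H -> H}) :
  normingA A T x0 -> s x0 < t -> A_bounded A S -> orthoA A T S ->
  innerA A (T x0) (S x0) = 0.
Proof.
move=> x0M st S_bnd TS; apply/eqP/negP => /negP; set c := innerA _ _ _ => c0.
have [/(normA_eq1 A_pos) x01 Tx0] := x0M.
have g0 : 0 < abs2 c.
  rewrite lt_neqAle abs2_ge0 andbT eq_sym; apply: contraNneq c0 => /abs2_eq0 ->.
  exact: eqxx.
have [_ [D0 SD0]] := (A_boundedP A_pos S).1 S_bnd.
pose D := abs2 c * `|D0|.
have D_ge0 : 0 <= D by rewrite mulr_ge0 ?abs2_ge0.
(* The factor [c] makes the real A-inner product of [T x0] and [U x0] equal to
   the positive number [abs2 c]. *)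
pose U x := c *: S x.
have UD x : q (U x) <= D * q x.
  rewrite /U (qAZ A_pos) /D -mulrA ler_wpM2l ?abs2_ge0 //.
  apply: le_trans (SD0 x) _; rewrite ler_wpM2r ?(qA_ge0 A_pos) //.
  exact: ler_norm.
have s0 := sup_orthA_ge0 A T x0.
have st2 : s x0 ^+ 2 < t ^+ 2 by rewrite ltr_pXn2r // nnegrE ?opnormA_ge0.
have E_ge0 : 0 <= t ^+ 2 * D by rewrite mulr_ge0 ?sqr_ge0.
have [e e0 est] := perturbation_estimate st2 g0 D_ge0 E_ge0.
have bound x : q x = 1 ->
    q (T x + (ofR (- e) * c) *: S x) <= t ^+ 2 - e * abs2 c.
  move=> x1.
  have dx := pythagoras A_pos x x01.
  have dT := pythagoras_image x x0M; rewrite /= in dT.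
  have := innerA_rejection A_pos x x01.
  move: dx dT; set a := innerA _ x x0; set u := a *: x0; set y := x - u.
  move=> dx dT x0y.
  have ey : x = u + y by rewrite /y addrC subrK.
  have n0 := qA_ge0 A_pos y; have a0 := abs2_ge0 a.
  have UB z : q z <= 1 -> q (U z) <= D.
    by move=> z1; apply: le_trans (UD z) _; rewrite ler_piMr.
  have w1 : re (T u) (U y) ^+ 2 <= (t ^+ 2 * D) * q y.
    apply: le_trans (cauchy_schwarz A_pos _ _) _.
    rewrite -mulrA; apply: ler_pM; rewrite ?(qA_ge0 A_pos) //.
    apply: le_trans (qA_image_le_opnormA A_pos T_bnd _) _.
    by rewrite ler_piMr ?sqr_ge0 // (qAZ A_pos) x01; lra.
  have w2 : re (T y) (U x) ^+ 2 <= (t ^+ 2 * D) * q y.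
    apply: le_trans (cauchy_schwarz A_pos _ _) _.
    rewrite mulrAC; apply: ler_pM; rewrite ?(qA_ge0 A_pos) //.
      exact: (qA_image_le_opnormA A_pos T_bnd).
    by apply: UB; rewrite x1.
  have := est (q y) _ _ n0 w1 w2; apply: le_trans.
  rewrite -scalerA -/(U x) (qADZ A_pos).
  have -> : re (T x) (U x) = re (T u) (U u) + re (T u) (U y) + re (T y) (U x).
    rewrite {1 2}ey linearD /= reADl; congr (_ + _); last by rewrite -ey.
    by rewrite -(reADr A_pos) /U -scalerDr -linearD.
  have -> : re (T u) (U u) = abs2 a * abs2 c.
    rewrite /U /u !linearZ /= (reAZ2 A_pos) /reA.
    by rewrite (innerAZr A_pos) -/c (mulrC (sconj c)).
  have yT := qA_image_le_sup_orthA A_pos T_bnd x0y.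
  have aE : abs2 a = 1 - q y by lra.
  have := ler_wpM2l (sqr_ge0 e) (UB x ltac:(by rewrite x1)).
  by rewrite dT aE; lra.
have M0 : 0 <= t ^+ 2 - e * abs2 c.
  by apply: le_trans (bound _ x01); exact: qA_ge0.
have := TS (ofR (- e) * c); apply/negP; rewrite -ltNge.
apply: (@le_lt_trans _ _ (Num.sqrt (t ^+ 2 - e * abs2 c))).
  apply: (opnormA_le A_pos) => [|x x1]; first exact: sqrtr_ge0.
  by rewrite sqr_sqrtr // bound.
have t0 : 0 <= t by exact: opnormA_ge0.
rewrite -[ltRHS](ger0_norm t0) -sqrtr_sqr ltr_sqrt.
  by have := mulr_gt0 e0 g0; lra.
by have := mulr_gt0 e0 g0; lra.
Qed.

Lemma smooth_of_gap x0 : normingA A T x0 -> s x0 < t -> A_smooth A T.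
Proof.
move=> x0M st S1 S2 b1 b2 o1 o2.
have b12 : A_bounded A (perturb S1 1 S2) by exact: A_boundedD.
have -> : (fun x => S1 x + S2 x) = perturb S1 1 S2.
  by apply/funext => x /=; rewrite /GRing.add_fun /GRing.scale_fun /= scale1r.
apply: (orthoA_of_vector (S := perturb S1 1 S2) b12 x0M).
rewrite /= scale1r (innerADr A).
by rewrite !norming_ortho_image // addr0.
Qed.

(** Without the gap, [T] would be orthogonal to both summands of
[T = <., x0>_A T x0 + S2], hence to itself. *)
Lemma gap_of_smooth x0 : 0 < t -> normingA A T x0 -> A_smooth A T -> s x0 < t.
Proof.
move=> t0 x0M smooth; rewrite ltNge; apply/negP => ts.
have [/(normA_eq1 A_pos) x01 Tx0] := x0M.
pose S1 : {linear H -> H} := rank_one A x0 (T x0).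
have b1 : A_bounded A S1 by exact: A_bounded_rank_one.
pose S2 := perturb T (-1) S1.
have b2 : A_bounded A S2 by exact: A_boundedD.
have o1 : orthoA A T S1.
  move=> l; apply: (le_trans ts); apply: sup_orthA_le_perturb => // y x0y.
  by rewrite /S1 /= /rank_one (innerAC A_pos) x0y sconj0 scale0r.
have o2 : orthoA A T S2.
  apply: (orthoA_of_vector b2 x0M); rewrite /S2 /=.
  rewrite /rank_one (innerA_self A_pos) x01 ofR1 scale1r scaleN1r subrr.
  by rewrite -(scale0r 0) (innerAZr A_pos) sconj0 mul0r.
(* The scalar -1 turns [T + l (S1 + S2)] into 0. *)
have := smooth S1 S2 b1 b2 o1 o2 (-1); apply/negP; rewrite -ltNge.
apply: le_lt_trans t0; apply: opnormA_le => // x _.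
have -> : T x + -1 *: (S1 x + S2 x) = 0.
  by rewrite /S2 /= !scaleN1r addrCA subrr addr0 subrr.
by rewrite (qA_ker (linear0 A)) expr0n.
Qed.

(** Equality in [||T z||_A <= t] forces the component of [z] off [x0] to vanish,
as [T] shrinks it by a factor below [t]. *)
Lemma norming_of_gap x0 z : normingA A T x0 -> s x0 < t -> normingA A T z ->
  `|innerA A z x0| = 1 /\ A (z - innerA A z x0 *: x0) = 0.
Proof.
move=> x0M st [/(normA_eq1 A_pos) z1 Tz].
have [/(normA_eq1 A_pos) x01 Tx0] := x0M.
have dz := pythagoras A_pos z x01.
have dT := pythagoras_image z x0M; rewrite /= in dT.
have yT := qA_image_le_sup_orthA A_pos T_bnd (innerA_rejection A_pos z x01).
move: dz dT yT; set a := innerA _ z x0; set y := z - _ => dz dT yT.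
have n0 := qA_ge0 A_pos y.
have s0 := sup_orthA_ge0 A T x0.
have st2 : s x0 ^+ 2 < t ^+ 2 by rewrite ltr_pXn2r // nnegrE ?opnormA_ge0.
have qy : q y = 0.
  apply/eqP; rewrite eq_le n0 andbT leNgt; apply/negP => y0.
  have aE : abs2 a = 1 - q y by lra.
  rewrite -(normA_sqr A_pos (T z)) Tz aE in dT.
  have : s x0 ^+ 2 * q y < t ^+ 2 * q y by rewrite ltr_pM2r.
  by lra.
split; last exact: (qA_eq0 A_pos).
by apply/abs2_eq1; lra.
Qed.

(** [T] maps the kernel of [A] into itself, because it is A-bounded. *)
Lemma norming_subker x y : A (x - y) = 0 -> normingA A T x -> normingA A T y.
Proof.
move=> xy [x1 Tx]; have Txy : A (T x - T y) = 0.
  apply: (qA_eq0 A_pos); apply/eqP.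
  rewrite eq_le (qA_ge0 A_pos) andbT -linearB.
  apply: le_trans (qA_image_le_opnormA A_pos T_bnd _) _.
  by rewrite (qA_ker xy) mulr0.
by split; [rewrite -x1|rewrite -Tx]; rewrite /normA;
  congr (Num.sqrt _); symmetry; exact: (qA_subker A_pos).
Qed.

Lemma normingZ a x : `|a| = 1 -> normingA A T x -> normingA A T (a *: x).
Proof.
move=> /abs2_eq1 a1 [x1 Tx].
have e y : normA A (a *: y) = normA A y.
  by rewrite /normA; congr Num.sqrt; rewrite -[LHS]/(q _) (qAZ A_pos) a1 mul1r.
by split; rewrite ?linearZ /= e.
Qed.

End Gap.

Theorem theorem2p9 (R : realType) (k : scalar_kind) (H : hilbertType R k)
    (A T : {linear H -> H})
    (A_pos : positive_operator A) (A_neq0 : exists x : H, A x <> 0)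
    (T_bnd : A_bounded A T) (T_neq0 : opnormA A T <> 0)
    (MT_neq0 : normingA A T !=set0) :
  A_smooth A T <->
  exists x0 : H,
    [/\ normA A x0 = 1,
        normingA A T `&` closure (range A)
          = [set mu *: x0 | mu in [set mu : scalars R k | `|mu| = 1]] &
        sup_orthA A T x0 < opnormA A T].
Proof.
have t0 : 0 < opnormA A T.
  by rewrite lt_neqAle opnormA_ge0 andbT eq_sym; apply/eqP.
split=> [smooth|[x0 [x01 Mset gap]]]; last first.
  have [x0M _] : (normingA A T `&` closure (range A)) x0.
    by rewrite Mset; exists 1; rewrite ?scale1r //= normr1.
  exact: (smooth_of_gap A_pos T_bnd x0M gap).
have [x1 x1M] := MT_neq0.
have [x0 x0cl x1x0] := projection_ker A_pos x1.
have x0M := norming_subker A_pos T_bnd x1x0 x1M.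
have gap := gap_of_smooth A_pos T_bnd t0 x0M smooth.
exists x0; split=> //; first by have [] := x0M.
apply/seteqP; split=> [z [zM zcl]|_ [mu mu1 <-]].
  have [a1 az] := norming_of_gap A_pos T_bnd x0M gap zM.
  exists (innerA A z x0) => //; apply/esym/eqP; rewrite -subr_eq0; apply/eqP.
  apply: (ker_closure_range A_pos az).
  by rewrite addrC -scaleNr; exact: closure_range_linear.
split; first exact: normingZ.
rewrite -[_ *: _]addr0; apply: closure_range_linear => //.
by apply: subset_closure; exists 0; rewrite ?linear0.
Qed.
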